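(* Let $d\ge 2$ and order the eigenspaces of the edge graph of the cross-polytope $\Diamond_d$ (the cocktail party graph) so that the eigenspace of the eigenvalue $-\frac{1}{d-1}$ is last. Then the graph has exactly $d$ minimal positively weighted extremal designs; each consists of $2$ antipodal vertices of $\Diamond_d$ and is combinatorial.
   Context: $\Diamond_d=\operatorname{conv}\{\pm e_i: i\in[d]\}\subset\mathbb{R}^d$. Its edge graph is the complete multipartite graph $K_{2,\dots,2}$ on the $2d$ vertices $\pm e_i$, in which every two vertices except antipodal pairs $e_i,-e_i$ are adjacent; it is $2(d-1)$-regular. For a connected $\delta$-regular graph $G$ on $n$ vertices with adjacency matrix $A$, eigenvalues and eigenspaces mean those of $\frac1\delta A$. Here the distinct eigenvalues are $1,\ -\frac1{d-1},\ 0$ with multiplicities $1,\ d-1,\ d$. The eigenspace $\operatorname{span}\{\mathbb{1}\}$ of the eigenvalue $1$ is always ordered first. A vertex subset $W$ with weights $(a_w)_{w\in W}$ averages an eigenspace $\Lambda$ if $\sum_{w\in W}a_w\phi(w)=\frac1n\sum_{v}\phi(v)$ for all $\phi\in\Lambda$. Given an ordering of the eigenspaces, $W$ is a positively weighted extremal design if there are weights $a_w>0$ with which $W$ averages every eigenspace except the last, and a combinatorial one if the weights can be taken to be $a_w=1/|W|$. Minimal means inclusion-minimal among positively weighted extremal designs. *)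

(* Defs.v *)
From mathcomp Require Import all_boot all_order all_algebra.
From mathcomp Require Import boolp classical_sets reals.
From mathcomp Require Import ring lra.

Set Implicit Arguments.
Unset Strict Implicit.
Unset Printing Implicit Defensive.

Import Order.TTheory GRing.Theory Num.Theory.
Local Open Scope ring_scope.

Section Polytope.
Variables (R : realType) (d : nat).
Implicit Types (c x y : 'rV[R]_d).

Definition dot c x : R := \sum_i c 0 i * x 0 i.

Definition conv_hull (T : finType) (p : T -> 'rV[R]_d) : set 'rV[R]_d :=
  [set x | exists a : T -> R,
     [/\ forall t, 0 <= a t, \sum_t a t = 1 & x = \sum_t a t *: p t]]%classic.

Definition segment x y : set 'rV[R]_d :=
  [set z | exists r : R, 0 <= r <= 1 /\ z = (1 - r) *: x + r *: y]%classic.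

Definition is_face (P F : set 'rV[R]_d) : Prop :=
  exists c (b : R), (forall x, P x -> dot c x <= b) /\
    F = [set x | P x /\ dot c x = b]%classic.

(* For [p] an injective enumeration of the vertices of the polytope
   [conv_hull p]. *)
Definition edge_graph (T : finType) (p : T -> 'rV[R]_d) : rel T :=
  fun u v => (u != v) && `[< is_face (conv_hull p) (segment (p u) (p v)) >].

(* [(i, false)] stands for the vertex e_i and [(i, true)] for -e_i. *)
Definition cross_vertex (u : 'I_d * bool) : 'rV[R]_d :=
  (-1) ^+ u.2 *: delta_mx 0 u.1.

Definition cross_graph : rel ('I_d * bool) := edge_graph cross_vertex.

End Polytope.

Section Designs.
Variables (R : realType) (T : finType) (e : rel T) (delta : nat).

Definition adj_mx : 'M[R]_#|T| :=
  \matrix_(i, j) (e (enum_val i) (enum_val j))%:R.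

Definition norm_adj_mx : 'M[R]_#|T| := delta%:R^-1 *: adj_mx.

(* The eigenspaces are ordered through their eigenvalues, as [1 :: s]. *)
Definition eigen_ordering (s : seq R) : Prop :=
  uniq (1 :: s) /\ forall lam, (lam \in 1 :: s) = eigenvalue norm_adj_mx lam.

(* [eigenspace] consists of row vectors [phi] with [phi *m M = lam *: phi];
   since the adjacency matrix is symmetric these are the usual eigenvectors.
   The value of [phi] at the vertex [w] is [phi 0 (enum_rank w)]. *)
Definition averages (W : {set T}) (a : T -> R) (lam : R) : Prop :=
  forall phi : 'rV[R]_#|T|, (phi <= eigenspace norm_adj_mx lam)%MS ->
    \sum_(w in W) a w * phi 0 (enum_rank w) =
    #|T|%:R^-1 * \sum_v phi 0 (enum_rank v).

(* [belast 1 s] is the list [1 :: s] without its last entry. *)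
Definition extremal_weights (s : seq R) (W : {set T}) (a : T -> R) : Prop :=
  (forall w, w \in W -> 0 < a w) /\
  (forall lam, lam \in belast 1 s -> averages W a lam).

Definition extremal_design (s : seq R) (W : {set T}) : Prop :=
  exists a : T -> R, extremal_weights s W a.

Definition combinatorial_design (s : seq R) (W : {set T}) : Prop :=
  extremal_weights s W (fun=> #|W|%:R^-1).

Definition minimal_designs (s : seq R) : {set {set T}} :=
  [set W | minset (fun W' : {set T} => `[< extremal_design s W' >]) W].

End Designs.

Section CrossPolytopeFacts.
Variables (R : realType) (d : nat).
Hypothesis d_ge2 : (2 <= d)%N.
Local Notation V := ('I_d * bool)%type.
Local Notation p := (@cross_vertex R d).
Local Notation G := (@cross_graph R d).

Lemma cross_vertexE (u : V) k : p u 0 k = (-1) ^+ u.2 * (k == u.1)%:R.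
Proof. by rewrite !mxE eqxx. Qed.

Lemma cross_vertex_inj : injective p.
Proof.
move=> [i b] [j b'] /rowP pE; have := pE i; rewrite {pE} !cross_vertexE /= eqxx.
case: eqP => [<-|_] pE; last by exfalso; case: b pE => /=; lra.
by case: b pE; case: b' => //= pE; exfalso; lra.
Qed.

Lemma cross_vertexN i b : p (i, ~~ b) = - p (i, b).
Proof. by apply/rowP => k; rewrite [RHS]mxE !cross_vertexE /=; case: b; ring. Qed.

Lemma dot_cross (c : 'rV[R]_d) (u : V) : dot c (p u) = (-1) ^+ u.2 * c 0 u.1.
Proof.
rewrite /dot (bigD1 u.1) //= big1 ?addr0 => [|k /negPf ki].
  by rewrite cross_vertexE eqxx mulr1 mulrC.
by rewrite cross_vertexE ki !mulr0.
Qed.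

Lemma dot_sum (T : finType) (c : 'rV[R]_d) (a : T -> R) (q : T -> 'rV[R]_d) :
  dot c (\sum_t a t *: q t) = \sum_t a t * dot c (q t).
Proof.
rewrite /dot; under eq_bigr => i _ do rewrite summxE mulr_sumr.
rewrite exchange_big; apply: eq_bigr => t _; rewrite mulr_sumr.
by apply: eq_bigr => i _; rewrite mxE mulrCA.
Qed.

Lemma conv_hull_vertex (T : finType) (q : T -> 'rV[R]_d) u : conv_hull q (q u).
Proof.
exists (fun t => (t == u)%:R); split=> [t||]; first exact: ler0n.
  by rewrite (bigD1 u) //= eqxx big1 ?addr0 // => t /negPf ->.
by rewrite (bigD1 u) //= eqxx scale1r big1 ?addr0 // => t /negPf ->; rewrite scale0r.
Qed.

Lemma exposed_edge (T : finType) (q : T -> 'rV[R]_d) c b u v : u != v ->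
  dot c (q u) = b -> dot c (q v) = b ->
  (forall w, w != u -> w != v -> dot c (q w) < b) -> edge_graph q u v.
Proof.
move=> uv cu cv cw; apply/andP; split=> //; apply/asboolP; exists c, b.
have cb w : dot c (q w) <= b.
  have [->|wu] := eqVneq w u; first by rewrite cu.
  have [->|wv] := eqVneq w v; first by rewrite cv.
  exact/ltW/cw.
have vu : v != u by rewrite eq_sym.
have conv2 (a : T -> R) : (forall w, w != u -> w != v -> a w = 0) ->
    forall (U : lmodType R) (h : T -> U),
    \sum_w a w *: h w = a u *: h u + a v *: h v.
  move=> a0 U h; rewrite (bigD1 u) //= (bigD1 v) //= big1 ?addr0 // => w.
  by case/andP=> wu wv; rewrite a0 // scale0r.
split=> [_ [a [a0 a1 ->]]|].
  rewrite dot_sum -[leRHS]mul1r -a1 mulr_suml.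
  by apply: ler_sum => t _; apply: ler_wpM2l.
apply/seteqP; split=> x /=.
  move=> [r [/andP[r0 r1] ->]].
  pose a w : R := if w == u then 1 - r else if w == v then r else 0.
  have aE := conv2 a; have a2 w : w != u -> w != v -> a w = 0.
    by rewrite /a => /negPf -> /negPf ->.
  have au : a u = 1 - r by rewrite /a eqxx.
  have av : a v = r by rewrite /a (negPf vu) eqxx.
  have xE : (1 - r) *: q u + r *: q v = \sum_w a w *: q w.
    by rewrite (aE a2) au av.
  split.
    exists a; split=> //.
      by move=> w; rewrite /a; case: ifP => _; [lra|case: ifP].
    have := aE a2 R^o (fun=> 1).
    under eq_bigr => w _ do rewrite /GRing.scale /= mulr1.
    by move=> ->; rewrite /GRing.scale /= !mulr1 au av subrK.
  rewrite xE dot_sum.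
  have := aE a2 R^o (fun w => dot c (q w)).
  by rewrite /GRing.scale /= => ->; rewrite au av cu cv; ring.
move=> [[a [a0 a1 ->]]]; rewrite dot_sum => sb.
have a2 w : w != u -> w != v -> a w = 0.
  move=> wu wv; have : \sum_w a w * (b - dot c (q w)) = 0.
    under eq_bigr => t _ do rewrite mulrBr.
    by rewrite sumrB sb -mulr_suml a1 mul1r subrr.
  move/eqP; rewrite psumr_eq0 => [/allP/(_ w)|t _]; last first.
    by rewrite mulr_ge0 // subr_ge0.
  rewrite mem_index_enum mulf_eq0 => /(_ isT) /orP[/eqP //|].
  by rewrite subr_eq0 => /eqP bE; have := cw w wu wv; rewrite -bE ltxx.
have auv : a u + a v = 1.
  rewrite -a1; have := conv2 a a2 R^o (fun=> 1).
  rewrite /GRing.scale /= !mulr1 => <-.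
  by apply: eq_bigr => w _; rewrite mulr1.
exists (a v); split; last by rewrite (conv2 a a2) -auv addrK.
by rewrite a0 /= -auv lerDr.
Qed.

(* The edge graph of the cross-polytope is K_{2,...,2}. *)
Lemma cross_graphE (u v : V) : G u v = (u.1 != v.1).
Proof.
case: u v => [i b] [j b'] /=; have [<-|ij] := eqVneq i j; last first.
  apply: (@exposed_edge _ _ (p (i, b) + p (j, b')) 1).
  - by apply: contraNneq ij => -[->].
  - rewrite dot_cross mxE !cross_vertexE /= eqxx (negPf ij).
    by case: b; rewrite /=; ring.
  - rewrite dot_cross mxE !cross_vertexE /= eqxx eq_sym (negPf ij).
    by case: b'; rewrite /=; ring.
  - move=> [k s]; rewrite !xpair_eqE dot_cross mxE !cross_vertexE /=.
    have [->|ki] := eqVneq k i; rewrite ?(negPf ij) //=.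
      by case: s; case: b => //= _ _; case: b'; rewrite /=; lra.
    have [_|_] := eqVneq k j => /=.
      by case: s; case: b' => //= _ _; case: b; rewrite /=; lra.
    by move=> _ _; rewrite !mulr0 addr0 mulr0 ltr01.
apply/negP => /andP[uv /asboolP[c [m [cm sE]]]].
have {uv} b'E : b' = ~~ b.
  by move: uv; rewrite xpair_eqE eqxx; case: b b' {sE} => [] [].
have hu : segment (p (i, b)) (p (i, b')) (p (i, b)).
  by exists 0; split; [rewrite lexx ler01|rewrite subr0 scale1r scale0r addr0].
have hv : segment (p (i, b)) (p (i, b')) (p (i, b')).
  by exists 1; split; [rewrite lexx ler01|rewrite subrr scale0r scale1r add0r].
have m0 : m = 0.
  have [_] : (conv_hull p `&` [set x | dot c x = m])%classic (p (i, b)).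
    by move: hu; rewrite sE.
  have [_] : (conv_hull p `&` [set x | dot c x = m])%classic (p (i, b')).
    by move: hv; rewrite sE.
  by rewrite /= !dot_cross b'E /=; case: (b) => /=; lra.
have [l li] : exists l : 'I_d, l != i.
  have /card_gt0P[l] : (0 < #|[set~ i]|)%N by rewrite cardsC1 card_ord; case: d d_ge2 => [|[]].
  by rewrite !inE => li; exists l.
have cl : dot c (p (l, false)) = 0.
  have := cm _ (@conv_hull_vertex _ p (l, false)).
  have := cm _ (@conv_hull_vertex _ p (l, true)).
  by rewrite !dot_cross /= m0; lra.
have : segment (p (i, b)) (p (i, b')) (p (l, false)).
  by rewrite sE; split; [exact: conv_hull_vertex|rewrite cl m0].
move=> [r [_ /rowP/(_ l)]]; rewrite !mxE !eqxx (negPf li) /=.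
by rewrite !mulr0 addr0 mulr1 => /eqP; rewrite oner_eq0.
Qed.

Lemma cross_graph_regular (u : V) :
  #|[set v | G u v]| = (2 * (d - 1))%N.
Proof.
have -> : [set v | G u v] = finset.setX [set~ u.1] [set: bool].
  by apply/setP => v; rewrite !inE cross_graphE eq_sym andbT.
by rewrite cardsX cardsC1 cardsT card_ord card_bool mulnC subn1.
Qed.

(* There is an ordering with -1/(d-1) last. *)
Lemma cross_graph_eigen_ordering :
  eigen_ordering G (2 * (d - 1)) [:: 0; - (d%:R - 1)^-1 : R].
Proof.
set dl : R := d%:R - 1.
have dl_gt0 : 0 < dl by rewrite subr_gt0 ltr1n.
have dl_neq0 : dl != 0 by rewrite gt_eqF.
have dlE : (2 * (d - 1))%:R = 2 * dl :> R by rewrite natrM natrB // ltnW.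
have actE (f : V -> R) (w : V) :
    ((\row_i f (enum_val i)) *m norm_adj_mx R G (2 * (d - 1))) 0 (enum_rank w) =
    (2 * dl)^-1 * (\sum_v f v - f w - f (w.1, ~~ w.2)).
  rewrite mxE -dlE.
  transitivity (\sum_v (2 * (d - 1))%:R^-1 * (f v * (v.1 != w.1)%:R)).
    rewrite (reindex (@enum_rank V)) /=; last by apply: onW_bij; exact: enum_rank_bij.
    by apply: eq_bigr => v _; rewrite !mxE !enum_rankK cross_graphE mulrCA.
  rewrite -mulr_sumr; congr (_ * _).
  rewrite [in RHS](bigD1 w) //= [in RHS](bigD1 (w.1, ~~ w.2)) /=; last first.
    by case: w => i [] /=; rewrite xpair_eqE andbF.
  rewrite (bigD1 w) //= (bigD1 (w.1, ~~ w.2)) /=; last first.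
    by case: w => i [] /=; rewrite xpair_eqE andbF.
  rewrite !eqxx !mulr0 !add0r [f w + _]addrC addrK [f _ + _]addrC addrK.
  apply: eq_bigr => -[i b] /andP[]; case: w => j b'; rewrite !xpair_eqE /=.
  by case: eqP => //= _; [case: b; case: b'|rewrite mulr1].
split.
  rewrite /= !inE negb_or oner_eq0 /= andbT; apply/andP; split.
    by apply/eqP => h; have := invr_gt0 dl; rewrite dl_gt0; lra.
  by rewrite eq_sym oppr_eq0 invr_eq0.
move=> lam; apply/idP/eigenvalueP; last first.
  move=> [phi phiM phi0]; set f := fun v : V => phi 0 (enum_rank v).
  have phiE : phi = \row_i f (enum_val i).
    by apply/rowP => i; rewrite mxE /f enum_valK.
  have fE w : 2 * dl * (lam * f w) = \sum_v f v - f w - f (w.1, ~~ w.2).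
    have := actE f w; rewrite -phiE phiM mxE => ->.
    by rewrite mulVKf // mulf_neq0 ?pnatr_eq0.
  have [w fw0] : exists w, f w != 0.
    have /rV0Pn[i fi] := phi0; exists (enum_val i).
    by rewrite /f enum_valK.
  rewrite !inE; have [//|lam0] := eqVneq lam 0; first by rewrite orbT.
  have fN v : f (v.1, ~~ v.2) = f v.
    have := fE v; have := fE (v.1, ~~ v.2); rewrite /= negbK -surjective_pairing.
    move=> h1 h2; apply/eqP; rewrite -subr_eq0.
    have /eqP : (2 * dl * lam) * (f (v.1, ~~ v.2) - f v) = 0.
      by lra.
    by rewrite !mulf_eq0 pnatr_eq0 (negPf dl_neq0) (negPf lam0).
  have gE v : (2 * dl * lam + 2) * f v = \sum_v f v.
    by have := fE v; rewrite fN; lra.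
  have [h|h] := eqVneq (2 * dl * lam + 2) 0.
    apply/orP; right; apply/eqP/(mulfI dl_neq0); rewrite mulrN mulfV //; lra.
  have fc v : f v = f w by apply: (mulfI h); rewrite !gE.
  have : \sum_v f v = 2 * d%:R * f w.
    under eq_bigr => v _ do rewrite fc.
    by rewrite sumr_const card_prod card_ord card_bool -[LHS]mulr_natl natrM; ring.
  rewrite -(gE w) => /(mulIf fw0) h'; apply/orP; left; apply/eqP.
  by apply: (mulfI dl_neq0); rewrite /dl in h' *; lra.
have eig (f : V -> R) (w0 : V) : f w0 != 0 ->
    (forall w, \sum_v f v - f w - f (w.1, ~~ w.2) = 2 * dl * (lam * f w)) ->
    exists2 v : 'rV_#|{: V}|, v *m norm_adj_mx R G (2 * (d - 1)) = lam *: v & v != 0.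
  move=> f0 fE; exists (\row_i f (enum_val i)); last first.
    by apply/rV0Pn; exists (enum_rank w0); rewrite mxE enum_rankK.
  apply/rowP => i; rewrite -(enum_valK i) actE fE mulKf ?mulf_neq0 ?pnatr_eq0 //.
  by rewrite !mxE enum_rankK.
have d_gt0 : (0 < d)%N by exact: ltnW.
pose i0 := Ordinal d_gt0; pose i1 := Ordinal d_ge2.
have i01 : i0 != i1 by [].
rewrite !inE => /or3P[] /eqP lamE.
- apply: (eig (fun=> 1) (i0, true)) => [|w]; first exact: oner_neq0.
  rewrite sumr_const card_prod card_ord card_bool lamE -[X in X - _ - _]mulr_natl natrM /dl; ring.
- apply: (eig (fun v => (-1) ^+ v.2) (i0, false)) => [|w]; first exact: oner_neq0.
  rewrite -(pair_bigA _ (fun (i : 'I_d) (b : bool) => (-1) ^+ b)) /= big1 => [|i _].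
    by rewrite lamE; case: (w.2) => /=; ring.
  by rewrite big_bool /=; ring.
- apply: (eig (fun v => (v.1 == i0)%:R - (v.1 == i1)%:R) (i0, false)) => [|w].
    by rewrite /= subr0 oner_neq0.
  rewrite -(pair_bigA _ (fun (i : 'I_d) (b : bool) => (i == i0)%:R - (i == i1)%:R)) /=.
  under eq_bigr => i _ do rewrite big_bool /=.
  have delta1 (k : 'I_d) : \sum_(i < d) (i == k)%:R = 1 :> R.
    by rewrite (bigD1 k) //= eqxx big1 ?addr0 // => i /negPf ->.
  rewrite big_split /= sumrB !delta1 lamE mulrA mulrN mulfK //; ring.
Qed.

End CrossPolytopeFacts.

(* Main.v *)
Require Import Defs.
From mathcomp Require Import all_boot all_order all_algebra.
From mathcomp Require Import boolp classical_sets reals.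
From mathcomp Require Import ring lra.

(** Two vertices are adjacent unless they share a coordinate axis, so for a
    function [phi] on the vertices the sum over the neighbours of [w] is the
    total sum minus [phi w] and minus the value at the antipode of [w]
    ([cross_eigenspaceP]).  Hence the eigenvectors for [1] are the constant
    functions, and those for [0] are the odd functions.  Averaging the former
    means that the weights on [W] have sum [1]; averaging the latter means that
    the weights, extended by zero outside [W], are an even function.

    As the two eigenspaces before the last one are those of [1] and [0], a set
    carries positive weights of this kind exactly if it is nonempty and
    centrally symmetric, and constant weights then work ([extremal_designE],
    [symmetric_combinatorial]).  The inclusion-minimal nonempty symmetric sets
    are the [d] pairs of antipodal vertices. *)

Set Implicit Arguments.
Unset Strict Implicit.
Unset Printing Implicit Defensive.

Import Order.TTheory GRing.Theory Num.Theory.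
Local Open Scope ring_scope.

Definition antipode (d : nat) (w : 'I_d * bool) : 'I_d * bool := (w.1, ~~ w.2).

Lemma antipodeK d : involutive (@antipode d).
Proof. by case=> i b; rewrite /antipode /= negbK. Qed.

Lemma antipode_neq d (w : 'I_d * bool) : antipode w != w.
Proof. by case: w => i []; rewrite xpair_eqE andbF. Qed.

Lemma eq_axis d (v w : 'I_d * bool) :
  (v.1 == w.1) = (v == w) || (v == antipode w).
Proof.
case: v w => [i b] [j b']; rewrite /antipode !xpair_eqE /=.
by case: (i == j); case: b; case: b'.
Qed.

Definition antipodal_pair (d : nat) (i : 'I_d) : {set 'I_d * bool} :=
  [set (i, false); (i, true)].

Lemma in_antipodal_pair d (i : 'I_d) w : (w \in antipodal_pair i) = (w.1 == i).
Proof.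
by case: w => j b; rewrite !inE !xpair_eqE /=; case: (j == i); case: b.
Qed.

Definition symmetric_set (d : nat) (W : {set 'I_d * bool}) : bool :=
  [forall w in W, antipode w \in W].

(** A nonempty symmetric set contains the whole antipodal pair on the axis of
    each of its points. *)
Lemma minset_symmetricE d (W : {set 'I_d * bool}) :
  minset (fun W' => (W' != finset.set0) && symmetric_set W') W =
  (W \in [set antipodal_pair i | i : 'I_d]).
Proof.
have pair_sym i :
    (antipodal_pair i != finset.set0) && symmetric_set (@antipodal_pair d i).
  apply/andP; split; first by apply/finset.set0Pn; exists (i, false); rewrite in_antipodal_pair.
  by apply/forall_inP => w; rewrite !in_antipodal_pair.
have pair_sub (A : {set 'I_d * bool}) w : symmetric_set A -> w \in A ->
    antipodal_pair w.1 \subset A.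
  move=> /forall_inP symA wA; apply/fintype.subsetP => v; rewrite in_antipodal_pair eq_axis.
  by case/orP=> /eqP -> //; apply: symA.
apply/minsetP/imsetP => [[/andP[/finset.set0Pn[w wW] symW] minW]|[i _ ->]].
  by exists w.1 => //; apply/esym/minW => //; exact: pair_sub.
split=> // B /andP[/finset.set0Pn[w wB] symB] subB; apply/eqP; rewrite finset.eqEsubset subB.
have := fintype.subsetP subB w wB; rewrite in_antipodal_pair => /eqP <-.
exact: pair_sub.
Qed.

Section CocktailParty.
Variables (R : realType) (d : nat).
Hypothesis d_ge2 : (2 <= d)%N.
Local Notation V := ('I_d * bool)%type.
Local Notation G := (@cross_graph R d).
Local Notation delta := (2 * (d - 1))%N.

Lemma card_cross_vertices : #|{: V}|%:R = d%:R * 2 :> R.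
Proof. by rewrite card_prod card_ord card_bool natrM. Qed.

Lemma degreeE : delta%:R = 2 * (d%:R - 1) :> R.
Proof. by rewrite natrM natrB // ltnW. Qed.

Lemma d_sub1_gt0 : 0 < d%:R - 1 :> R.
Proof. by rewrite subr_gt0 ltr1n. Qed.

Lemma sum_antipode (f : V -> R) : \sum_v f (antipode v) = \sum_v f v.
Proof. by rewrite [RHS](reindex_inj (inv_inj (@antipodeK d))). Qed.

(** The adjacency operator is the sum over all vertices minus the identity and
    minus the antipodal map. *)
Lemma cross_eigenspaceP (lam : R) (phi : 'rV[R]_#|{: V}|) :
  (phi <= eigenspace (norm_adj_mx R G delta) lam)%MS <->
  forall w, lam * delta%:R * phi 0 (enum_rank w) =
    \sum_v phi 0 (enum_rank v) - phi 0 (enum_rank w)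
      - phi 0 (enum_rank (antipode w)).
Proof.
have delta_neq0 : delta%:R != 0 :> R.
  by rewrite degreeE mulf_neq0 ?pnatr_eq0 // gt_eqF // d_sub1_gt0.
have actE w : delta%:R * (phi *m norm_adj_mx R G delta) 0 (enum_rank w) =
    \sum_v phi 0 (enum_rank v) - phi 0 (enum_rank w)
      - phi 0 (enum_rank (antipode w)).
  rewrite mxE mulr_sumr (reindex (@enum_rank V)) /=; last first.
    by apply: onW_bij; exact: enum_rank_bij.
  have E v : delta%:R * (phi 0 (enum_rank v)
      * norm_adj_mx R G delta (enum_rank v) (enum_rank w)) =
      phi 0 (enum_rank v) * (v.1 != w.1)%:R.
    by rewrite !mxE !enum_rankK cross_graphE // mulrCA mulVKf.
  under eq_bigr do rewrite E.
  rewrite (bigD1 w) //= (bigD1 (antipode w)) ?antipode_neq //=.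
  rewrite [in RHS](bigD1 w) //= [in RHS](bigD1 (antipode w)) ?antipode_neq //=.
  rewrite !eqxx !mulr0 !add0r [phi 0 _ + (_ + _)]addrC addrK [phi 0 _ + _]addrC addrK.
  apply: eq_bigr => v /andP[vw vw']; rewrite eq_axis.
  by rewrite (negPf vw) (negPf vw') mulr1.
split=> [/eigenspaceP phiE w|phiE].
  by rewrite -actE phiE mxE mulrCA mulrA.
apply/eigenspaceP/rowP => i; rewrite -(enum_valK i); apply: (mulfI delta_neq0).
by rewrite actE -phiE mxE mulrCA mulrA.
Qed.

(** Subtracting the eigenvalue equations at [w] and at its antipode shows that
    an eigenvector [phi] for [1] is even; each equation then reads
    [2d * phi w = \sum_v phi v], so that [phi] is constant. *)
Lemma averages1E (W : {set V}) (a : V -> R) :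
  averages G delta W a 1 <-> \sum_(w in W) a w = 1.
Proof.
have d_gt0 := d_sub1_gt0.
split=> [avg|sum_a phi /cross_eigenspaceP phiE].
  have /avg : (\row_(_ < #|{: V}|) (1 : R) <= eigenspace (norm_adj_mx R G delta) 1)%MS.
    apply/cross_eigenspaceP => w; rewrite degreeE !mxE.
    under eq_bigr do rewrite mxE.
    by rewrite sumr_const card_cross_vertices; ring.
  under eq_bigr do rewrite mxE mulr1.
  move=> ->; under eq_bigr do rewrite mxE.
  by rewrite sumr_const mulVf // card_cross_vertices mulf_neq0 //; lra.
set S := \sum_v _ in phiE *.
have phi_const w : phi 0 (enum_rank w) = #|{: V}|%:R^-1 * S.
  have := phiE w; have := phiE (antipode w); rewrite antipodeK degreeE => h1 h2.
  have ev : phi 0 (enum_rank (antipode w)) = phi 0 (enum_rank w).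
    by apply: (mulfI (lt0r_neq0 d_gt0)); lra.
  have n0 : #|{: V}|%:R != 0 :> R by rewrite card_cross_vertices mulf_neq0 //; lra.
  by apply: (mulfI n0); rewrite mulVKf // card_cross_vertices; lra.
under eq_bigr do rewrite phi_const.
by rewrite -mulr_suml sum_a mul1r.
Qed.

(** The eigenvalue equations say that [phi] has the same sum on every antipodal
    pair as on the whole vertex set; with at least two pairs this sum is zero,
    so the eigenvectors for [0] are odd.  Pairing to zero with all of them is
    evenness of the weights. *)
Lemma averages0E (W : {set V}) (a : V -> R) :
  averages G delta W a 0 <->
  forall w, (if w \in W then a w else 0) =
            (if antipode w \in W then a (antipode w) else 0).
Proof.
have d_gt0 := d_sub1_gt0.
split=> [avg w|a_even phi /cross_eigenspaceP phiE].
  (* The odd functions are spanned by differences of antipodal point masses. *)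
  pose f v : R := (v == w)%:R - (v == antipode w)%:R.
  have fE v : (\row_(i < #|{: V}|) f (enum_val i)) 0 (enum_rank v) = f v.
    by rewrite mxE enum_rankK.
  have sum_point (u : V) : \sum_v (v == u)%:R = 1 :> R.
    by rewrite (bigD1 u) //= eqxx big1 ?addr0 // => v /negPf ->.
  have sum_f : \sum_v f v = 0 by rewrite sumrB !sum_point subrr.
  have /avg : (\row_(i < #|{: V}|) f (enum_val i)
                <= eigenspace (norm_adj_mx R G delta) 0)%MS.
    apply/cross_eigenspaceP => v; under eq_bigr do rewrite fE.
    rewrite sum_f !fE /f (can2_eq (@antipodeK d) (@antipodeK d)).
    by rewrite (inj_eq (inv_inj (@antipodeK d))); ring.
  under eq_bigr do rewrite fE.
  under [in X in _ = X]eq_bigr do rewrite fE.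
  rewrite sum_f mulr0 big_mkcond /=.
  have pointE u : \sum_v (if v \in W then a v else 0) * (v == u)%:R =
      if u \in W then a u else 0.
    rewrite (bigD1 u) //= eqxx mulr1 big1 ?addr0 // => v /negPf ->.
    by rewrite mulr0.
  move=> sum0; apply/eqP; rewrite -subr_eq0 -!pointE -sumrB -[X in _ == X]sum0.
  apply/eqP/eq_bigr => v _; rewrite /f -mulrBr.
  by case: ifP => _; rewrite ?mul0r.
set S := \sum_v _ in phiE *.
have phi_antipode w : phi 0 (enum_rank w) + phi 0 (enum_rank (antipode w)) = S.
  by have := phiE w; lra.
(* Adding these identities over all vertices gives S + S = 2d S. *)
have S0 : S = 0.
  have : S + S = d%:R * 2 * S.
    rewrite -[X in _ + X](sum_antipode (fun v => phi 0 (enum_rank v))) -big_split /=.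
    under eq_bigr do rewrite phi_antipode.
    by rewrite sumr_const -[LHS]mulr_natl card_cross_vertices.
  by move=> h; apply: (mulfI (lt0r_neq0 d_gt0)); lra.
rewrite S0 mulr0 big_mkcond /=.
set T := \sum_v _.
suff : T = - T by lra.
rewrite {1}/T -sum_antipode /T -sumrN; apply: eq_bigr => v _.
have -> : phi 0 (enum_rank (antipode v)) = - phi 0 (enum_rank v).
  by have := phi_antipode v; rewrite S0; lra.
have := a_even v; case: ifP => _; case: ifP => _ ev.
- by rewrite ev mulrN.
- by rewrite ev mul0r oppr0.
- by rewrite -ev mul0r oppr0.
- by rewrite oppr0.
Qed.

Section Ordering.
Variable s : seq R.
Hypothesis s_ordering : eigen_ordering G delta s.
Hypothesis s_last : last 1 s = - (d%:R - 1)^-1.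

Lemma mem_eigen_init lam : (lam \in belast 1 s) = (lam == 1) || (lam == 0).
Proof.
have [uniq_s mem_s] := s_ordering.
have [uniq_std mem_std] := cross_graph_eigen_ordering R d_ge2.
have : lam \in 1 :: s = (lam \in [:: 1; 0; - (d%:R - 1)^-1]).
  by rewrite mem_s mem_std.
move: uniq_s; rewrite lastI s_last rcons_uniq mem_rcons => /andP[last_notin _].
move: uniq_std; rewrite /= !inE => /and3P[/norP[_ one_neq] zero_neq _].
have [-> _|_] := eqVneq lam (- (d%:R - 1)^-1).
  by rewrite (negPf last_notin) eq_sym (negPf one_neq) eq_sym (negPf zero_neq).
by rewrite /= orbF.
Qed.

Lemma extremal_weightsE (W : {set V}) (a : V -> R) :
  extremal_weights G delta s W a <->
  [/\ forall w, w \in W -> 0 < a w, \sum_(w in W) a w = 1 &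
      forall w, (if w \in W then a w else 0) =
                (if antipode w \in W then a (antipode w) else 0)].
Proof.
split=> [[a_gt0 avg]|[a_gt0 sum_a a_even]].
  split=> //; first by apply/averages1E/avg; rewrite mem_eigen_init eqxx.
  by apply/averages0E/avg; rewrite mem_eigen_init eqxx orbT.
split=> // lam; rewrite mem_eigen_init => /orP[]/eqP ->.
  exact/averages1E.
exact/averages0E.
Qed.

Lemma symmetric_combinatorial (W : {set V}) :
  W != finset.set0 -> symmetric_set W -> combinatorial_design G delta s W.
Proof.
move=> W_neq0 /forall_inP symW; have W_gt0 : (0 < #|W|)%N by rewrite card_gt0.
apply/extremal_weightsE; split=> [w _||w]; first by rewrite invr_gt0 ltr0n.
  by rewrite sumr_const -[LHS]mulr_natl divff // pnatr_eq0 -lt0n.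
suff -> : (antipode w \in W) = (w \in W) by [].
by apply/idP/idP => /symW; rewrite ?antipodeK.
Qed.

(** Evenness of the weights forces the antipode of a point of positive weight
    to carry a nonzero weight as well, hence to lie in the set. *)
Lemma extremal_designE (W : {set V}) :
  `[< extremal_design G delta s W >] = (W != finset.set0) && symmetric_set W.
Proof.
apply/asboolP/andP => [[a /extremal_weightsE[a_gt0 sum_a a_even]]|[W_neq0 symW]].
  split.
    apply/eqP => W0; move: sum_a; rewrite W0 big_set0 => /eqP.
    by rewrite eq_sym oner_eq0.
  apply/forall_inP => w wW; have := a_even w; rewrite wW.
  by case: ifP => // _ aw0; have := a_gt0 _ wW; rewrite aw0 ltxx.
by exists (fun=> #|W|%:R^-1); exact: symmetric_combinatorial.
Qed.

Lemma minimal_designsE :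
  minimal_designs G delta s = [set antipodal_pair i | i : 'I_d].
Proof.
apply/setP => W; rewrite -minset_symmetricE inE.
apply: minset_eq. exact: extremal_designE.
Qed.

End Ordering.
End CocktailParty.

Theorem theorem4p2 (R : realType) (d : nat) (hd : (2 <= d)%N) (s : seq R)
    (hs : eigen_ordering (@cross_graph R d) (2 * (d - 1)) s)
    (hlast : last 1 s = - (d%:R - 1)^-1) :
  #|minimal_designs (@cross_graph R d) (2 * (d - 1)) s| = d /\
  forall W : {set 'I_d * bool},
    W \in minimal_designs (@cross_graph R d) (2 * (d - 1)) s ->
    (exists u v : 'I_d * bool,
       [/\ u != v, cross_vertex R v = - cross_vertex R u & W = [set u; v]]) /\
    combinatorial_design (@cross_graph R d) (2 * (d - 1)) s W.
Proof.
rewrite (minimal_designsE hd hs hlast); split=> [|W Wpair].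
  rewrite card_imset ?card_ord // => i j pair_ij.
  by apply/eqP; rewrite -(in_antipodal_pair j (i, false)) -pair_ij in_antipodal_pair.
split.
  have /imsetP[i _ ->] := Wpair; exists (i, false), (i, true).
  by rewrite xpair_eqE andbF; split=> //; exact: (cross_vertexN R i false).
move: Wpair; rewrite -minset_symmetricE => /minsetp/andP[W_neq0 symW].
exact: symmetric_combinatorial.
Qed.
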